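(* ${\sf CAC}$ and $\omega\text{-}{\sf CAC}$ are equivalent under generalized Weihrauch reducibility: ${\sf CAC}\le_{\mathrm{gW}}\omega\text{-}{\sf CAC}$ and $\omega\text{-}{\sf CAC}\le_{\mathrm{gW}}{\sf CAC}$.
   Context: A poset $(P,\le_P)$ consists of $P\subseteq\omega$ and a reflexive, antisymmetric, transitive relation $\le_P$ on $P$; chains (antichains) are sets of pairwise comparable (incomparable) elements; it is $\omega$-ordered if $x\le_P y$ implies $x\le y$. A problem consists of a class of instances (subsets of $\omega$) and, for each instance, a class of solutions. ${\sf CAC}$ is the problem whose instances are infinite posets $(P,\le_P)$ with $P\subseteq\omega$ and whose solutions are infinite chains or infinite antichains of the instance; $\omega\text{-}{\sf CAC}$ is ${\sf CAC}$ restricted to $\omega$-ordered instances. For problems $\mathsf P,\mathsf Q$, the reduction game $G(\mathsf Q\to\mathsf P)$ is played as follows: Player I first plays a $\mathsf P$-instance $X_0$; Player II either plays an $X_0$-computable solution to $X_0$ (and wins) or plays a $\mathsf Q$-instance $Y_1\le_T X_0$. At move $n>1$, Player I plays a solution $X_{n-1}$ to the $\mathsf Q$-instance $Y_{n-1}$, and Player II either plays a $\bigoplus_{i<n}X_i$-computable solution to $X_0$ (and wins) or a $\mathsf Q$-instance $Y_n\le_T\bigoplus_{i<n}X_i$. If Player II cannot respond, or never wins, Player I wins. $\mathsf P\le_{\mathrm{gW}}\mathsf Q$ means Player II has a winning computable strategy, i.e. a Turing functional which, given the join of Player I's first $n$ moves, outputs Player II's $n$th move (together with a flag saying whether it is a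 winning solution), and which wins against every play of Player I. *)

(* Defs.v *)
From Stdlib Require Cantor.
From mathcomp Require Import all_boot.
From mathcomp Require Import boolp classical_sets functions cardinality.

Set Implicit Arguments.
Unset Strict Implicit.
Unset Printing Implicit Defensive.

Local Open Scope classical_set_scope.

(** * Oracle computability *)

Definition cpair (x y : nat) : nat := Cantor.to_nat (x, y).
Definition cfst (n : nat) : nat := (Cantor.of_nat n).1.
Definition csnd (n : nat) : nat := (Cantor.of_nat n).2.

(** Kleene's schemes for the functions partial recursive in an oracle, with
    tuples of arguments packed by the Cantor pairing bijection. *)
Inductive code : Type :=
  | CZero | CSucc | CFst | CSnd | COracle
  | CPair of code & code
  | CComp of code & code
  | CPrec of code & code
  | CMu of code.

(** [eval O c n m]: the partial function with index [c] and oracle [O]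
    converges on [n] with value [m].  For [CPrec] the sequence [w] is the course
    of values of the recursion, and for [CMu] all values below the least zero
    [m] have to converge. *)
Fixpoint eval (O : nat -> nat) (c : code) (n m : nat) : Prop :=
  match c with
  | CZero => m = 0
  | CSucc => m = n.+1
  | CFst => m = cfst n
  | CSnd => m = csnd n
  | COracle => m = O n
  | CPair f g => exists a b, [/\ eval O f n a, eval O g n b & m = cpair a b]
  | CComp f g => exists2 a, eval O g n a & eval O f a m
  | CPrec f g => exists w : nat -> nat,
      [/\ eval O f (cfst n) (w 0),
          forall k, k < csnd n ->
            eval O g (cpair (cfst n) (cpair k (w k))) (w k.+1)
        & m = w (csnd n)]
  | CMu f => eval O f (cpair n m) 0 /\
      forall k, k < m -> exists v, eval O f (cpair n k) v.+1
  end.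

Definition char_fun (A : set nat) (n : nat) : nat := `[< A n >].

(** The Turing functional with index [e] maps [A] to [B]. *)
Definition maps_to (e : code) (A B : set nat) : Prop :=
  forall n, eval (char_fun A) e n (char_fun B n).

Definition turing_le (B A : set nat) : Prop := exists e, maps_to e A B.

(** * Problems *)

Record problem := Problem {
  instance : set (set nat);
  solution : set nat -> set (set nat)  (* relevant on instances only *)
}.

(** * Reduction games *)

(** A move of Player II: the flag says whether the set played is claimed to be
    a solution to the initial instance, or else is the next instance.  It is
    coded by a single subset of [nat], with the flag as its bit 0. *)
Definition move : Type := bool * set nat.

Definition move_code (m : move) : set nat :=
  [set k | if k is x.+1 then m.2 x else m.1].

(** The join of the finite sequence [X 0, ..., X (n - 1)].  Column 0 records the
    length of the sequence, which could otherwise not be recovered from the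
    join, and column [i + 1] is [X i]. *)
Definition join (X : nat -> set nat) (n : nat) : set nat :=
  [set k | if cfst k is i.+1 then i < n /\ X i (csnd k) else csnd k < n].

Section Game.
Variables Q P : problem.

(** In the game G(Q -> P), Player I plays [X 0, X 1, ...] and Player II plays
    [Y 1, Y 2, ...], in the order [X 0, Y 1, X 1, Y 2, ...]; [Y 0] is unused. *)

Definition legalI (X : nat -> set nat) (Y : nat -> move) (n : nat) : Prop :=
  if n is 0 then instance P (X 0) else solution Q (Y n).2 (X n).

Definition legalII (X : nat -> set nat) (n : nat) (m : move) : Prop :=
  turing_le m.2 (join X n) /\
  if m.1 then solution P (X 0) m.2 else instance Q m.2.

(** It is Player II's turn to make move [n], the moves before it being legal
    and Player II not having won yet. *)
Definition to_moveII (X : nat -> set nat) (Y : nat -> move) (n : nat) : Prop :=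
  (forall i, i < n -> legalI X Y i) /\
  (forall i, 0 < i < n -> legalII X i (Y i) /\ (Y i).1 = false).

Definition answers (e : code) (X : nat -> set nat) (n : nat) (m : move) : Prop :=
  maps_to e (join X n) (move_code m).

Definition follows (e : code) (X : nat -> set nat) (Y : nat -> move) (n : nat) :
    Prop :=
  forall i, 0 < i < n -> answers e X i (Y i).

(** Player II can always respond, and no play goes on forever. *)
Definition winning (e : code) : Prop :=
  (forall X Y n, 0 < n -> to_moveII X Y n -> follows e X Y n ->
     exists2 m, answers e X n m & legalII X n m) /\
  ~ (exists X Y, forall n, to_moveII X Y n /\ follows e X Y n).

End Game.

Definition gW_le (P Q : problem) : Prop := exists e, winning Q P e.

(** * Posets and the chain-antichain principle *)

Record is_poset (P : set nat) (le : nat -> nat -> Prop) : Prop := IsPoset {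
  poset_field : forall x y, le x y -> P x /\ P y;
  poset_refl : forall x, P x -> le x x;
  poset_anti : forall x y, le x y -> le y x -> x = y;
  poset_trans : forall x y z, le x y -> le y z -> le x z
}.

Definition comparable_in (le : nat -> nat -> Prop) (x y : nat) : Prop :=
  le x y \/ le y x.

Definition chain (P : set nat) (le : nat -> nat -> Prop) (S : set nat) : Prop :=
  S `<=` P /\ forall x y, S x -> S y -> comparable_in le x y.

Definition antichain (P : set nat) (le : nat -> nat -> Prop) (S : set nat) :
    Prop :=
  S `<=` P /\ forall x y, S x -> S y -> x <> y -> ~ comparable_in le x y.

Definition omega_ordered (le : nat -> nat -> Prop) : Prop :=
  forall x y, le x y -> x <= y.

(** A subset [X] of [nat] codes the pair consisting of a set and a binary
    relation whose join [X] is: evens for the set, odds for the relation. *)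
Definition carrier (X : set nat) : set nat := [set x | X x.*2].
Definition order_rel (X : set nat) (x y : nat) : Prop := X (cpair x y).*2.+1.

Definition CAC : problem := {|
  instance := [set X | is_poset (carrier X) (order_rel X) /\
                       infinite_set (carrier X)];
  solution := fun X => [set S | infinite_set S /\
    (chain (carrier X) (order_rel X) S \/ antichain (carrier X) (order_rel X) S)]
|}.

Definition omegaCAC : problem := {|
  instance := [set X | instance CAC X /\ omega_ordered (order_rel X)];
  solution := solution CAC
|}.

(* Main.v *)
(** Let [x <=0 y] mean [x <= y] and [x <=P y]; this order is omega-ordered.
    Player II first asks for an infinite chain or antichain [S] of it, and then
    for an infinite chain or antichain [T] of the relation on [S] "[x <= y], and
    [x] and [y] are comparable in [P]".  If [S] is a [<=0]-chain, the latter
    relation is the usual order on [S]; if [S] is a [<=0]-antichain, it is the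
    converse of [<=P] on [S].  In both cases it is an omega-ordered partial order
    with the same comparabilities as [<=P], so that [T] solves the initial
    instance.  Player II need not know which of the two cases holds. *)
From Stdlib Require Cantor.
From mathcomp Require Import all_boot.
From mathcomp Require Import boolp classical_sets functions cardinality.
Require Import Defs.

Set Implicit Arguments.
Unset Strict Implicit.
Unset Printing Implicit Defensive.

Local Open Scope classical_set_scope.

(** * Pairing and determinism of evaluation *)

Lemma cfst_pair x y : cfst (cpair x y) = x.
Proof. by rewrite /cfst /cpair Cantor.cancel_of_to. Qed.

Lemma csnd_pair x y : csnd (cpair x y) = y.
Proof. by rewrite /csnd /cpair Cantor.cancel_of_to. Qed.

Lemma cpair_fst_snd n : cpair (cfst n) (csnd n) = n.
Proof. by rewrite /cpair /cfst /csnd -surjective_pairing Cantor.cancel_to_of. Qed.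

(** Needed so that an index for a strategy determines Player II's moves. *)
Lemma eval_fun O c n m1 m2 : eval O c n m1 -> eval O c n m2 -> m1 = m2.
Proof.
elim: c n m1 m2 => [||||| f IHf g IHg | f IHf g IHg | f IHf g IHg | f IHf] n m1 m2 /=;
  try by move=> -> ->.
- move=> [a [b [fa gb ->]]] [a' [b' [fa' gb' ->]]].
  by rewrite (IHf _ _ _ fa fa') (IHg _ _ _ gb gb').
- move=> [a ga fa] [b gb fb]; rewrite (IHg _ _ _ ga gb) in fa.
  exact: IHf fa fb.
- move=> [w [w0 wS ->]] [v [v0 vS ->]].
  have: csnd n <= csnd n by [].
  (* The index is generalized to any [k] up to the fixed bound [csnd n]: the two courses of values
     agree only that far. *)
  elim: {-2}(csnd n) => [_|k IHk ltk]; first exact: IHf w0 v0.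
  have /= := vS _ ltk; rewrite -(IHk (ltnW ltk)).
  by move=> /(IHg _ _ _ (wS _ ltk)).
(* If the zeros differed, minimality of the larger would give a successor value at the smaller. *)
- move=> [f1 lt1] [f2 lt2]; case: (ltngtP m1 m2) => // [/lt2|/lt1] [v fv].
  + by have := IHf _ _ _ f1 fv.
  + by have := IHf _ _ _ f2 fv.
Qed.

(** * Functions and predicates computable uniformly in an oracle *)

(** A single index serves all oracles, since a strategy has to be one functional. *)
Definition computable (F : set nat -> nat -> nat) : Prop :=
  exists c, forall A n, eval (char_fun A) c n (F A n).

Definition decidable_in (R : set nat -> nat -> Prop) : Prop :=
  computable (fun A => char_fun (R A)).

Lemma eq_computable F G : (forall A n, F A n = G A n) -> computable F -> computable G.
Proof. by move=> FG [c cF]; exists c => A n; rewrite -FG. Qed.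

Lemma computable_id : computable (fun=> id).
Proof.
exists (CPair CFst CSnd) => A n /=; exists (cfst n), (csnd n).
by split=> //; rewrite cpair_fst_snd.
Qed.

Lemma computable_comp F G :
  computable F -> computable G -> computable (fun A n => F A (G A n)).
Proof. by move=> [f cf] [g cg]; exists (CComp f g) => A n /=; exists (G A n). Qed.

Lemma computable_pair F G :
  computable F -> computable G -> computable (fun A n => cpair (F A n) (G A n)).
Proof. by move=> [f cf] [g cg]; exists (CPair f g) => A n /=; exists (F A n), (G A n). Qed.

Lemma computable_succ F : computable F -> computable (fun A n => (F A n).+1).
Proof. by apply: (@computable_comp (fun=> S)); exists CSucc. Qed.

Lemma computable_fst F : computable F -> computable (fun A n => cfst (F A n)).
Proof. by apply: (@computable_comp (fun=> cfst)); exists CFst. Qed.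

Lemma computable_snd F : computable F -> computable (fun A n => csnd (F A n)).
Proof. by apply: (@computable_comp (fun=> csnd)); exists CSnd. Qed.

Lemma computable_const k : computable (fun _ _ => k).
Proof. by elim: k => [|k /computable_succ //]; exists CZero. Qed.

(** [CPrec] is run on the pair of [n] and the bound [K A n], so the step function still has access
    to [n]. *)
Lemma computable_rec (B K : set nat -> nat -> nat)
    (G : set nat -> nat -> nat -> nat -> nat) :
  computable B ->
  computable (fun A z => G A (cfst z) (cfst (csnd z)) (csnd (csnd z))) ->
  computable K ->
  computable (fun A n => nat_rect (fun=> nat) (B A n) (G A n) (K A n)).
Proof.
move=> [b cb] [g cg] [k ck]; have [i ci] := computable_id.
exists (CComp (CPrec b g) (CPair i k)) => A n /=; exists (cpair n (K A n)).
  by exists n, (K A n); split=> //; apply: ci.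
exists (nat_rect (fun=> nat) (B A n) (G A n)); rewrite cfst_pair csnd_pair.
split=> // j _ /=.
by have := cg A (cpair n (cpair j (nat_rect (fun=> nat) (B A n) (G A n) j)));
  rewrite !(cfst_pair, csnd_pair).
Qed.

Lemma computable_pred F : computable F -> computable (fun A n => (F A n).-1).
Proof.
move=> cF; have := computable_rec (G := fun _ _ k _ => k) (computable_const 0)
  (computable_fst (computable_snd computable_id)) cF.
by apply: eq_computable => A n; case: (F A n).
Qed.

Lemma computable_sub F G :
  computable F -> computable G -> computable (fun A n => F A n - G A n).
Proof.
move=> cF; have := computable_rec (G := fun _ _ _ w => w.-1) cF
  (computable_pred (computable_snd (computable_snd computable_id))).
move=> h /h; apply: eq_computable => A n.
by elim: (G A n) => [|k /= ->]; rewrite ?subn0 ?subnS.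
Qed.

Lemma computable_double F : computable F -> computable (fun A n => (F A n).*2).
Proof.
have := computable_rec (G := fun _ _ _ w => w.+2) (computable_const 0)
  (computable_succ (computable_succ (computable_snd (computable_snd computable_id)))).
move=> h /h; apply: eq_computable => A n.
by elim: (F A n) => [|k /= ->].
Qed.

(** Recursion with the boolean as its bound: zero steps leave [G], one step overwrites it with
    [F]. *)
Lemma computable_if (b : set nat -> nat -> bool) F G :
  computable (fun A n => b A n) -> computable F -> computable G ->
  computable (fun A n => if b A n then F A n else G A n).
Proof.
move=> cb cF cG; have := computable_rec (G := fun A n _ _ => F A n) cG
  (computable_comp cF (computable_fst computable_id)) cb.
by apply: eq_computable => A n; case: (b A n).
Qed.

Lemma computable_odd F : computable F -> computable (fun A n => odd (F A n)).
Proof.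
have := computable_rec (G := fun _ _ _ w => 1 - w) (computable_const 0)
  (computable_sub (computable_const 1) (computable_snd (computable_snd computable_id))).
move=> h /h; apply: eq_computable => A n.
by elim: (F A n) => [|k /= ->] //=; case: (odd k).
Qed.

Lemma computable_half F : computable F -> computable (fun A n => (F A n)./2).
Proof.
have csn := computable_snd computable_id.
have := computable_rec (G := fun _ _ k w => if odd k then w.+1 else w)
  (computable_const 0)
  (computable_if (computable_odd (computable_fst csn))
     (computable_succ (computable_snd csn)) (computable_snd csn)).
move=> h /h; apply: eq_computable => A n.
by elim: (F A n) => [|k /= ->] //=; rewrite uphalf_half; case: (odd k).
Qed.

Lemma eq_decidable_in R S :
  (forall A n, R A n <-> S A n) -> decidable_in R -> decidable_in S.
Proof.
move=> RS; apply: eq_computable => A n.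
by rewrite /char_fun; congr (nat_of_bool `[< _ >]); apply/propext.
Qed.

Lemma decidable_bool (b : set nat -> nat -> bool) :
  computable (fun A n => b A n) -> decidable_in b.
Proof. by apply: eq_computable => A n; rewrite /char_fun asboolb. Qed.

Lemma decidable_oracle F : computable F -> decidable_in (fun A n => A (F A n)).
Proof. by apply: (@computable_comp (fun A => char_fun A)); exists COracle. Qed.

Lemma decidable_comp R F :
  decidable_in R -> computable F -> decidable_in (fun A n => R A (F A n)).
Proof. by move=> cR cF; exact: (computable_comp cR cF). Qed.

Lemma decidable_if R S T :
  decidable_in R -> decidable_in S -> decidable_in T ->
  decidable_in (fun A n => if `[< R A n >] then S A n else T A n).
Proof.
move=> cR cS cT; have := computable_if cR cS cT.
by apply: eq_computable => A n; rewrite /char_fun; case: ifP.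
Qed.

Lemma decidable_const (P : Prop) : decidable_in (fun _ _ => P).
Proof. exact: computable_const. Qed.

Lemma decidable_and R S :
  decidable_in R -> decidable_in S -> decidable_in (fun A n => R A n /\ S A n).
Proof.
move=> cR cS; have := decidable_if cR cS (decidable_const False).
by apply: eq_decidable_in => A n; case: asboolP; tauto.
Qed.

Lemma decidable_or R S :
  decidable_in R -> decidable_in S -> decidable_in (fun A n => R A n \/ S A n).
Proof.
move=> cR cS; have := decidable_if cR (decidable_const True) cS.
by apply: eq_decidable_in => A n; case: asboolP; tauto.
Qed.

Lemma decidable_imply R S :
  decidable_in R -> decidable_in S -> decidable_in (fun A n => R A n -> S A n).
Proof.
move=> cR cS; have := decidable_if cR cS (decidable_const True).
by apply: eq_decidable_in => A n; case: asboolP; tauto.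
Qed.

Lemma decidable_leq F G :
  computable F -> computable G -> decidable_in (fun A n => F A n <= G A n).
Proof.
move=> cF cG; have := computable_sub (computable_const 1) (computable_sub cF cG).
by apply: eq_computable => A n; rewrite /char_fun asboolb -subn_eq0; case: (F A n - G A n).
Qed.

(** * Computable strategies *)

Definition computable_strategy (S : set nat -> move) : Prop :=
  decidable_in (fun A => move_code (S A)).

Lemma computable_strategy_pair b R :
  decidable_in R -> computable_strategy (fun A => (b, R A)).
Proof.
move=> cR; have := decidable_if
  (decidable_leq computable_id (computable_const 0)) (decidable_const b)
  (decidable_comp cR (computable_pred computable_id)).
by apply: eq_decidable_in => A [|n]; rewrite /= asboolb.
Qed.

Lemma computable_strategy_if k S T :
  computable_strategy S -> computable_strategy T ->
  computable_strategy (fun A => if `[< A k >] then S A else T A).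
Proof.
move=> cS cT; have := decidable_if (decidable_oracle (computable_const k)) cS cT.
by apply: eq_decidable_in => A n; case: asboolP.
Qed.

Lemma move_code_inj : injective move_code.
Proof.
move=> [b B] [c C] eBC.
have eBCn k : move_code (b, B) k = move_code (c, C) k by rewrite eBC.
congr pair; last by apply/funext => n; exact: (eBCn n.+1).
by move: (eBCn 0) => /= /propeqP [bc cb]; apply/idP/idP.
Qed.

Lemma maps_to_fun e A B C : maps_to e A B -> maps_to e A C -> B = C.
Proof.
move=> eB eC; apply/funext => n; have := eval_fun (eB n) (eC n).
by move=> /(can_inj oddb) eBC; exact: propext (asbool_eq_equiv eBC).
Qed.

Lemma maps_to_move_turing e A m : maps_to e A (move_code m) -> turing_le m.2 A.
Proof. by move=> em; exists (CComp e CSucc) => n /=; exists n.+1 => //; exact: em. Qed.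

(** Reduces a win to the mathematical content of each move. Determinism and injectivity of
    [move_code] force a play following the index to follow [S], and the Turing bound on a move comes
    from the computability of [S]. *)
Lemma computable_strategy_winning Q P S N :
  computable_strategy S -> 0 < N ->
  (forall X, (S (join X N)).1) ->
  (forall X Y n, 0 < n -> to_moveII Q P X Y n ->
     (forall i, 0 < i < n -> Y i = S (join X i)) ->
     let m := S (join X n) in
     if m.1 then solution P (X 0) m.2 else instance Q m.2) ->
  exists e, winning Q P e.
Proof.
move=> [e eS] N_gt0 SN Swin; exists e.
have fS X Y n : follows e X Y n -> forall i, 0 < i < n -> Y i = S (join X i).
  by move=> eY i /eY ei; apply: move_code_inj; apply: maps_to_fun ei (eS _).
split=> [X Y n n_gt0 XYn eY|[X [Y XY]]].
  exists (S (join X n)); first exact: eS.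
  split; first exact: maps_to_move_turing (eS _).
  exact: Swin (fS _ _ _ eY).
(* An endless play would reach move [N.+1], so move [N] would carry flag false; but [S] declares a
   solution there. *)
have [[_ Yf] /fS YS] := XY N.+1.
have Nlt : 0 < N < N.+1 by rewrite N_gt0 ltnSn.
by have [_] := Yf _ Nlt; rewrite YS // SN.
Qed.

(** * Reading the history of a play off its join *)

Definition column (A : set nat) (i : nat) : set nat := [set x | A (cpair i.+1 x)].

Lemma column_join X n i : i < n -> column (join X n) i = X i.
Proof.
move=> lt_in; apply/seteqP; split=> x; rewrite /column /join /= cfst_pair csnd_pair.
  by case.
by [].
Qed.

Lemma join_length X n k : join X n (cpair 0 k) = (k < n).
Proof. by rewrite /join /= cfst_pair csnd_pair. Qed.

Lemma decidable_column i F :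
  computable F -> decidable_in (fun A n => column A i (F A n)).
Proof.
by move=> cF; apply: decidable_oracle (computable_pair (computable_const i.+1) cF).
Qed.

(** * The two omega-ordered posets *)

(** The code of the order [<=0]: for odd [z], halving drops the tag bit and leaves the pair. *)
Definition omega_part (X : set nat) : set nat :=
  [set z | X z /\ (odd z -> cfst z./2 <= csnd z./2)].

Definition comparability (X S : set nat) : set nat :=
  [set z | if `[< odd z >] then
             [/\ S (cfst z./2), S (csnd z./2), cfst z./2 <= csnd z./2
               & comparable_in (order_rel X) (cfst z./2) (csnd z./2)]
           else S z./2].

Lemma carrier_omega_part X : carrier (omega_part X) = carrier X.
Proof.
by apply/seteqP; split=> x; rewrite /carrier /omega_part /= odd_double => // -[].
Qed.

Lemma order_rel_omega_part X x y :
  order_rel (omega_part X) x y <-> order_rel X x y /\ x <= y.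
Proof.
rewrite /order_rel /omega_part /= odd_double uphalf_double cfst_pair csnd_pair /=.
by split=> -[? ?]; split=> //; auto.
Qed.

Lemma carrier_comparability X S : carrier (comparability X S) = S.
Proof.
by apply/seteqP; split=> x; rewrite /carrier /comparability /= asboolb odd_double doubleK.
Qed.

Lemma order_rel_comparability X S x y :
  order_rel (comparability X S) x y <->
  [/\ S x, S y, x <= y & comparable_in (order_rel X) x y].
Proof.
by rewrite /order_rel /comparability /= asboolb odd_double uphalf_double cfst_pair csnd_pair.
Qed.

Lemma omega_part_instance X :
  instance CAC X -> instance omegaCAC (omega_part X).
Proof.
move=> [[field refl anti trans] infX].
split; last by move=> x y /order_rel_omega_part [].
split; rewrite carrier_omega_part //; split.
- by move=> x y /order_rel_omega_part [/field].
- by move=> x Xx; apply/order_rel_omega_part; split=> //; exact: refl.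
- by move=> x y /order_rel_omega_part [xy _] /order_rel_omega_part [yx _]; exact: anti.
- move=> x y z /order_rel_omega_part [xy lexy] /order_rel_omega_part [yz leyz].
  by apply/order_rel_omega_part; split; [exact: trans xy yz | exact: leq_trans leyz].
Qed.

(** The delicate axiom is transitivity: comparability is not transitive in a general poset, and here
    the homogeneity of [S] for [<=0] supplies it. *)
Lemma comparability_instance X S :
  instance CAC X -> solution omegaCAC (omega_part X) S ->
  instance omegaCAC (comparability X S).
Proof.
move=> [[field refl anti trans] _] [infS solS].
split; last by move=> x y /order_rel_comparability [].
have subS : S `<=` carrier X.
  by rewrite -carrier_omega_part; case: solS => -[].
split; rewrite carrier_comparability //; split.
- by move=> x y /order_rel_comparability [].
- move=> x Sx; apply/order_rel_comparability; split=> //.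
  by left; apply: refl; exact: subS.
- move=> x y /order_rel_comparability [_ _ lexy _] /order_rel_comparability [_ _ leyx _].
  by apply/eqP; rewrite eqn_leq lexy.
move=> x y z /order_rel_comparability [Sx Sy lexy cxy].
move=> /order_rel_comparability [_ Sz leyz cyz].
apply/order_rel_comparability; split=> //; first exact: leq_trans leyz.
case: solS => -[_ solS].
  (* Chain case: any two elements of [S] are comparable in [X]. *)
  by case: (solS x z Sx Sz) => /order_rel_omega_part [? _]; [left | right].
(* Antichain case: for distinct [a <= b], having [a] below [b] in [X] would make them
   [<=0]-comparable, so only the converse direction remains. *)
have conv a b : S a -> S b -> a <= b -> comparable_in (order_rel X) a b ->
    order_rel X b a.
  move=> Sa Sb leab [ab|//]; have [<-|/eqP neq] := eqVneq a b.
    by apply: refl; exact: subS.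
  by case: (solS a b Sa Sb neq); left; apply/order_rel_omega_part.
by right; apply: trans (conv _ _ Sy Sz leyz cyz) (conv _ _ Sx Sy lexy cxy).
Qed.

Lemma comparability_solution X S T :
  S `<=` carrier X -> solution omegaCAC (comparability X S) T -> solution CAC X T.
Proof.
move=> subS [infT solT]; split=> //.
have subT : T `<=` S.
  by rewrite -(carrier_comparability X S); case: solT => -[].
have comparableE x y : T x -> T y ->
    comparable_in (order_rel (comparability X S)) x y <->
    comparable_in (order_rel X) x y.
  move=> /subT Sx /subT Sy; split.
    by case=> /order_rel_comparability [_ _ _ []]; [left|right|right|left].
  (* Totality of the usual order orients every comparable pair. *)
  move=> cxy; case/orP: (leq_total x y) => le; [left|right];
    apply/order_rel_comparability; split=> //.
  by case: cxy; [right|left].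
have subTX : T `<=` carrier X by move=> x /subT /subS.
case: solT => -[_ solT]; [left|right]; split=> // x y Tx Ty.
  by apply/comparableE => //; exact: solT.
by move=> neq /comparableE-/(_ Tx Ty); exact: solT.
Qed.

(** * The two reductions *)

(** By [join_length], the bit at [cpair 0 k] tells whether more than [k] moves of Player I are
    recorded; the longest history is tested first. *)
Definition CAC_strategy (A : set nat) : move :=
  if `[< A (cpair 0 2) >] then (true, column A 2)
  else if `[< A (cpair 0 1) >] then (false, comparability (column A 0) (column A 1))
  else (false, omega_part (column A 0)).

Lemma computable_CAC_strategy : computable_strategy CAC_strategy.
Proof.
have cz := computable_id; have ch := computable_half cz.
have ch1 := computable_fst ch; have ch2 := computable_snd ch.
have codd := decidable_bool (computable_odd cz).
have cle := decidable_leq ch1 ch2.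
apply: computable_strategy_if; first exact/computable_strategy_pair/decidable_column.
apply: computable_strategy_if; apply: computable_strategy_pair; last first.
  by apply: decidable_and (decidable_imply codd cle); exact: decidable_column.
apply: decidable_if => //; last exact: decidable_column.
(* The order of the initial instance is a membership query to column 0. *)
have cord F G : computable F -> computable G ->
    decidable_in (fun A n => order_rel (column A 0) (F A n) (G A n)).
  move=> cF cG; apply: decidable_column.
  exact: computable_succ (computable_double (computable_pair cF cG)).
have := decidable_and (decidable_and (decidable_column 1 ch1) (decidable_column 1 ch2))
  (decidable_and cle (decidable_or (cord _ _ ch1 ch2) (cord _ _ ch2 ch1))).
by apply: eq_decidable_in => A n; split=> [[[? ?] [? ?]]|[]].
Qed.

Lemma CAC_le_omegaCAC : gW_le CAC omegaCAC.
Proof.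
(* Two queries, then the solution at move 3. *)
apply: (computable_strategy_winning (N := 3) computable_CAC_strategy) => //.
  by move=> X; rewrite /CAC_strategy join_length asboolb.
move=> X Y n n_gt0 [XI _] YE.
have X0 := XI 0 n_gt0.
(* Each past query is computed from the strategy, which tells what Player I's legal reply to it
   solves. *)
have Y1 : 1 < n -> Y 1 = (false, omega_part (X 0)).
  by move=> n_gt1; rewrite YE // /CAC_strategy !join_length !asboolb /= column_join.
have X1 : 1 < n -> solution omegaCAC (omega_part (X 0)) (X 1).
  by move=> n_gt1; have := XI 1 n_gt1; rewrite /= Y1.
have Y2 : 2 < n -> Y 2 = (false, comparability (X 0) (X 1)).
  by move=> n_gt2; rewrite YE // /CAC_strategy !join_length !asboolb /= !column_join.
have X2 : 2 < n -> solution CAC (X 0) (X 2).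
  move=> n_gt2; apply: (@comparability_solution _ (X 1)).
    by rewrite -carrier_omega_part; case: (X1 (ltnW n_gt2)) => _ [] [].
  by have := XI 2 n_gt2; rewrite /= Y2.
rewrite /CAC_strategy !join_length !asboolb.
case: (boolP (2 < n)) => n_gt2; first by rewrite column_join //=; exact: X2.
case: (boolP (1 < n)) => n_gt1; rewrite !column_join //=.
  exact: comparability_instance (X1 n_gt1).
exact: omega_part_instance.
Qed.

(** An omega-ordered instance is already a [CAC] instance with the same solutions: it is passed on
    unchanged, and the reply is returned at move 2. *)
Definition omegaCAC_strategy (A : set nat) : move :=
  if `[< A (cpair 0 1) >] then (true, column A 1) else (false, column A 0).

Lemma computable_omegaCAC_strategy : computable_strategy omegaCAC_strategy.
Proof.
by apply: computable_strategy_if; apply: computable_strategy_pair;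
  apply: decidable_column; exact: computable_id.
Qed.

Lemma omegaCAC_le_CAC : gW_le omegaCAC CAC.
Proof.
apply: (computable_strategy_winning (N := 2) computable_omegaCAC_strategy) => //.
  by move=> X; rewrite /omegaCAC_strategy join_length asboolb.
move=> X Y n n_gt0 [XI _] YE.
rewrite /omegaCAC_strategy join_length asboolb.
case: (boolP (1 < n)) => n_gt1; rewrite column_join //=; last by case: (XI 0 n_gt0).
have := XI 1 n_gt1; rewrite /= YE // /omegaCAC_strategy join_length asboolb.
by rewrite /= column_join.
Qed.

Theorem theorem4 : gW_le CAC omegaCAC /\ gW_le omegaCAC CAC.
Proof. split; [exact: CAC_le_omegaCAC | exact: omegaCAC_le_CAC]. Qed.
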